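(* Let $r\ge2$ and write the weight one vectorial Eisenstein series on $\Omega^r$ in coordinates as $\mathcal E_1=(\epsilon_r,\epsilon_{r-1},\dots,\epsilon_1)^{tr}$. Then for all $i=1,2,\dots,r$ and all $\bm z\in\Omega^r$ we have $\epsilon_i(\bm z)\ne0$ in $\mathbb{T}$. In particular, $\mathcal E_1$ is nowhere-vanishing on $\Omega^r$.
   Context: Let $\mathbb{F}_q$ be the finite field with $q$ elements, $A=\mathbb{F}_q[\theta]$, $K_\infty=\mathbb{F}_q((\theta^{-1}))$, and $\mathbb{C}_\infty$ the completion of an algebraic closure of $K_\infty$, with absolute value normalized by $|\theta|=q$. $\mathbb{T}$ is the Tate algebra, the completion of $\mathbb{C}_\infty[t]$ for the Gauss norm $\|\sum f_it^i\|=\max|f_i|$. Let $\chi_t:A\to\mathbb{F}_q[t]\subset\mathbb{T}$ be the $\mathbb{F}_q$-algebra map $\theta\mapsto t$, and $\rho_t$ its entrywise extension to column vectors over $A$. $\Omega^r$ is the set of row vectors $\bm z=(z_r,z_{r-1},\dots,z_1)\in\mathbb{C}_\infty^r$ with $z_1=1$ and $z_1,\dots,z_r$ linearly independent over $K_\infty$. The weight one vectorial Eisenstein series $\mathcal E_1:\Omega^r\to\mathbb{T}^r$ is $\mathcal E_1(\bm z)=\sum_{0\ne\bm a\in A^r}(\bm z\bm a)^{-1}\rho_t(\bm a)$, where $A^r$ and $\mathbb{T}^r$ consist of column vectors; thus, with $\bm a=(a_r,\dots,a_1)^{tr}$, $\epsilon_i(\bm z)=\sum_{0\ne\bm a\in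 A^r}(\bm z\bm a)^{-1}\chi_t(a_i)$. The series converge in $\mathbb{T}$. *)

(* Defs.v *)
(* MathComp / MathComp-Analysis. *)
From mathcomp Require Import all_boot all_order all_algebra finmap.
From mathcomp Require Import all_classical all_reals all_analysis.

Set Implicit Arguments.
Unset Strict Implicit.
Unset Printing Implicit Defensive.

Import Order.TTheory GRing.Theory Num.Theory.
Import numFieldTopology.Exports numFieldNormedType.Exports.

Local Open Scope classical_set_scope.
Local Open Scope ring_scope.

(* Norms are plain functions into a realType: MathComp's normedZmodType demands
   `|x *+ n| = `|x| *+ n, which fails in positive characteristic. *)
Section Norms.
Variables (R : realType) (V : zmodType) (N : V -> R).

Record ultrametric_norm : Prop := UltrametricNorm {
  norm_ge0 : forall x, 0 <= N x;
  norm_eq0 : forall x, N x = 0 <-> x = 0;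
  norm_sub : forall x y, N (x - y) <= Num.max (N x) (N y) }.

Definition converges_to (u : nat -> V) (l : V) : Prop :=
  N (u n - l) @[n --> \oo] --> (0 : R).

Definition cauchy_sequence (u : nat -> V) : Prop :=
  forall e : R, 0 < e ->
    exists n0 : nat, forall m n, (n0 <= m)%N -> (n0 <= n)%N -> N (u m - u n) < e.

Definition norm_complete : Prop :=
  forall u, cauchy_sequence u -> exists l, converges_to u l.

Definition norm_dense (D : set V) : Prop :=
  forall x (e : R), 0 < e -> exists2 y, D y & N (x - y) < e.

Definition has_sum (I : choiceType) (P : pred I) (f : I -> V) (s : V) : Prop :=
  forall e : R, 0 < e -> exists J0 : {fset I}, forall J : {fset I},
    (J0 `<=` J)%fset -> N (s - \sum_(i <- J | P i) f i) < e.

(* The junk value 0 of a divergent family is harmless here: it would make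
   the non-vanishing of a sum false. *)
Definition infinite_sum (I : choiceType) (P : pred I) (f : I -> V) : V :=
  xget 0 [set s | has_sum P f s].

End Norms.

Section InfinitePlace.
Variables (F : finFieldType) (R : realType) (C : fieldType) (N : C -> R).
Variables (iota : {rmorphism F -> C}) (theta : C).

(* The subfield F((theta^-1)) of C: all convergent sums
   theta^d * (c_0 + c_1 theta^-1 + c_2 theta^-2 + ...) with c_k in F. *)
Definition laurent_subfield : set C :=
  [set x | exists (d : nat) (c : nat -> F),
     converges_to N
       (fun n => theta ^+ d * \sum_(k < n) iota (c k) * theta ^- k) x].

Definition laurent_algebraic : set C :=
  [set x | exists p : {poly C},
     [/\ p != 0, (forall k, laurent_subfield p`_k) & root p x]].

End InfinitePlace.

(* A completion of an algebraic closure of K_oo = F((theta^-1)), normalised by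
   |theta| = q.  K_oo is laurent_subfield; its algebraic closure is the set of
   elements of the carrier that are algebraic over K_oo.  The absolute value is
   automatically trivial on the finite field F, hence the usual one on K_oo and
   its unique extension to the algebraic closure.  This determines the
   structure up to isometric isomorphism. *)
Record Cinfty (F : finFieldType) (R : realType) := MkCinfty {
  Cinfty_field :> fieldType;
  cabs : Cinfty_field -> R;
  cconst : {rmorphism F -> Cinfty_field};
  theta : Cinfty_field;
  cabs_norm : ultrametric_norm cabs;
  cabsM : forall x y, cabs (x * y) = cabs x * cabs y;
  cabs_theta : cabs theta = #|F|%:R;
  Cinfty_alg_closed : forall p : {poly Cinfty_field}, (1 < size p)%N ->
    (forall k, laurent_algebraic cabs cconst theta p`_k) ->
    exists2 x, laurent_algebraic cabs cconst theta x & root p x;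
  Cinfty_dense : norm_dense cabs (laurent_algebraic cabs cconst theta);
  Cinfty_complete : norm_complete cabs }.

Definition Kinfty (F : finFieldType) (R : realType) (C : Cinfty F R) : set C :=
  laurent_subfield (@cabs F R C) (@cconst F R C) (theta C).

Definition gauss_norm (F : finFieldType) (R : realType) (C : Cinfty F R)
    (p : {poly C}) : R :=
  \big[Num.max/0]_(k < size p) cabs p`_k.

(* A completion of the C_oo-algebra C_oo[t] for the Gauss norm; tpoly is the
   canonical embedding, which sends 'X to t. *)
Record tate_algebra (F : finFieldType) (R : realType) (C : Cinfty F R) :=
  MkTateAlgebra {
  tate_alg :> comAlgType C;
  tnorm : tate_alg -> R;
  tpoly : {lrmorphism {poly C} -> tate_alg};
  tnorm_norm : ultrametric_norm tnorm;
  tnormZ : forall c x, tnorm (c *: x) = cabs c * tnorm x;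
  tnormM : forall x y, tnorm (x * y) <= tnorm x * tnorm y;
  tnorm_tpoly : forall p, tnorm (tpoly p) = gauss_norm p;
  tate_dense : norm_dense tnorm (range tpoly);
  tate_complete : norm_complete tnorm }.

Section Eisenstein.
Variables (F : finFieldType) (R : realType) (C : Cinfty F R).
Variable T : tate_algebra C.

(* A = F[theta] is {poly F}, embedded in C by 'X |-> theta. *)
Definition A_embed (a : {poly F}) : C := (map_poly (@cconst F R C) a).[theta C].

Definition chi_t (a : {poly F}) : T := tpoly T (map_poly (@cconst F R C) a).

Definition rho_t (r : nat) (a : 'cV[{poly F}]_r) : 'cV[T]_r := map_mx chi_t a.

(* Vectors are indexed z = (z_r, ..., z_1), so the ordinal j : 'I_r stands for
   the index r - j and the last coordinate is z_1. *)
Definition Omega (r : nat) : set 'rV[C]_r :=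
  [set z | (forall j : 'I_r, j.+1 = r -> z 0 j = 1) /\
           (forall c : 'I_r -> C, (forall j, Kinfty (c j)) ->
              \sum_j c j * z 0 j = 0 -> forall j, c j = 0)].

Definition pairing (r : nat) (z : 'rV[C]_r) (a : 'cV[{poly F}]_r) : C :=
  (z *m map_mx A_embed a) 0 0.

Definition eisenstein1 (r : nat) (z : 'rV[C]_r) : 'cV[T]_r :=
  \col_(j < r) infinite_sum (@tnorm F R C T) [pred a : 'cV[{poly F}]_r | a != 0]
                 (fun a => (pairing z a)^-1 *: rho_t a j 0).

(* The component epsilon_(r - j). *)
Definition epsilon (r : nat) (j : 'I_r) (z : 'rV[C]_r) : T :=
  eisenstein1 z j 0.

End Eisenstein.

(* Main.v *)
(* Only the constant term of eps_i in t matters.  Write v = z_i, and let W be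
   the lattice of all z a with a_i divisible by theta.  Sorting the a with
   a_i(0) <> 0 by the value c = a_i(0) and factoring c out, the constant term is
   (q - 1) sum_(w in W) 1 / (v + w) = - 1 / e_W(v), where
   e_W(X) = X prod_(w <> 0) (1 - X / w) is the exponential of W, a finite number
   since W is discrete.  To avoid infinite products, W is truncated to degrees
   < d: then prod_w (X + w) is an additive polynomial, the sum equals
   prod_(w <> 0) w / prod_w (v + w), and its absolute value no longer depends
   on d for large d, as |v + w| = |w| for |w| > |v|. *)
Require Import Defs.
From mathcomp Require Import all_boot all_order all_algebra all_field finmap.
From mathcomp Require Import all_classical all_reals all_analysis.

Set Implicit Arguments.
Unset Strict Implicit.
Unset Printing Implicit Defensive.

Import Order.TTheory GRing.Theory Num.Theory.
Import numFieldTopology.Exports numFieldNormedType.Exports.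

Local Open Scope classical_set_scope.
Local Open Scope ring_scope.

(** * Ultrametric norms and unordered summation *)

Section Ultrametric.
Variables (R : realType) (V : zmodType) (N : V -> R).
Hypothesis HN : ultrametric_norm N.

Lemma unorm0 : N 0 = 0.
Proof. exact/(norm_eq0 HN). Qed.

Lemma unormN x : N (- x) = N x.
Proof.
suff le y : N (- y) <= N y by apply/eqP; rewrite eq_le le -{1}[x]opprK le.
by have := norm_sub HN 0 y; rewrite sub0r unorm0 (max_idPr (norm_ge0 HN y)).
Qed.

Lemma unormD x y : N (x + y) <= Num.max (N x) (N y).
Proof. by rewrite -{1}[y]opprK -(unormN y) norm_sub. Qed.

Lemma unorm_gt0 x : (0 < N x) = (x != 0).
Proof.
rewrite lt_neqAle (norm_ge0 HN) andbT eq_sym; congr (~~ _).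
by apply/eqP/eqP => /(norm_eq0 HN).
Qed.

Lemma unormD_lt e x y : N x < e -> N y < e -> N (x + y) < e.
Proof. by move=> xe ye; rewrite (le_lt_trans (unormD x y))// gt_max xe. Qed.

Lemma unormB_lt e x y : N x < e -> N y < e -> N (x - y) < e.
Proof. by move=> xe ye; apply: unormD_lt; rewrite ?unormN. Qed.

(** Otherwise [y = (x + y) - x] would be a difference of two elements of norm below [N y]. *)
Lemma unormD_eq x y : N x < N y -> N (x + y) = N y.
Proof.
move=> xy; apply/eqP; rewrite eq_le; apply/andP; split.
  by rewrite (le_trans (unormD x y))// ge_max lexx ltW.
rewrite leNgt; apply/negP => xy_lt.
by have := unormB_lt xy_lt xy; rewrite addrC addKr ltxx.
Qed.

Lemma unorm_sum_lt (I : eqType) (s : seq I) (P : pred I) (f : I -> V) e :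
  0 < e -> (forall i, i \in s -> P i -> N (f i) < e) ->
  N (\sum_(i <- s | P i) f i) < e.
Proof.
move=> e_gt0 fe; rewrite big_seq_cond.
elim/big_ind: _ => [|x y|i /andP[]]; first by rewrite unorm0.
  exact: unormD_lt.
exact: fe.
Qed.

Lemma unorm_sum_le (I : Type) (s : seq I) (P : pred I) (f : I -> V) e :
  0 <= e -> (forall i, P i -> N (f i) <= e) ->
  N (\sum_(i <- s | P i) f i) <= e.
Proof.
move=> e_ge0 fe; elim/big_ind: _ => [|x y xe ye|]; rewrite ?unorm0//.
by rewrite (le_trans (unormD x y))// ge_max xe.
Qed.

Lemma converges_toP (u : nat -> V) (l : V) : converges_to N u l <->
  forall e, 0 < e -> exists n0, forall n, (n0 <= n)%N -> N (u n - l) < e.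
Proof.
rewrite /converges_to; split => [/cvgrPdist_lt ul e /ul[n0 _ le]|ul].
  exists n0 => n /le /=.
  by rewrite sub0r normrN ger0_norm ?(norm_ge0 HN).
apply/cvgrPdist_lt => e /ul[n0 le]; exists n0 => // n /le /=.
by rewrite sub0r normrN ger0_norm ?(norm_ge0 HN).
Qed.

Section Summation.
Variables (I : choiceType) (P : pred I) (f : I -> V).

(** The common part [A] meet [B] cancels. If [A] and [B] both contain all large terms of a family,
    only small terms remain. *)
Lemma fsum_sub (A B : {fset I}) :
  \sum_(i <- A | P i) f i - \sum_(i <- B | P i) f i =
  \sum_(i <- A | P i && (i \notin B)) f i -
  \sum_(i <- B | P i && (i \notin A)) f i.
Proof.
rewrite (bigID (mem B)) [X in _ - X](bigID (mem A)) /=.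
rewrite [X in (_ + _) - (X + _)](_ : _ = \sum_(i <- A | P i && (i \in B)) f i).
  by rewrite opprD addrACA subrr add0r.
rewrite -big_filter -[RHS]big_filter; apply: perm_big.
apply: uniq_perm; rewrite ?filter_uniq ?fset_uniq// => i.
by rewrite !mem_filter -!andbA [X in _ && X]andbC.
Qed.

Definition vanishing_family : Prop := forall e : R, 0 < e ->
  exists J : {fset I}, forall i, i \notin J -> P i -> N (f i) < e.

(** The partial sums over the exceptional sets [J n] for the thresholds [1 / (n + 1)] form a Cauchy
    sequence: by the ultrametric inequality a finite sum of small terms is small, however many terms
    it has. *)
Lemma vanishing_has_sum :
  norm_complete N -> vanishing_family -> exists s, has_sum N P f s.
Proof.
move=> Nc fv.
have /choice[J HJ] n : exists J : {fset I},
    forall i, i \notin J -> P i -> N (f i) < n.+1%:R^-1.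
  by apply: fv; rewrite invr_gt0 ltr0n.
pose u n := \sum_(i <- J n | P i) f i.
have small (e : R) : 0 < e -> exists n0 : nat,
    forall n, (n0 <= n)%N -> n.+1%:R^-1 < e.
  move=> e0; exists (Num.truncn e^-1) => n le.
  rewrite invf_plt ?posrE ?ltr0n//.
  by rewrite (lt_le_trans (truncnS_gt _))// ler_nat ltnS.
have sub n e (A : {fset I}) : n.+1%:R^-1 < e ->
    N (\sum_(i <- A | P i && (i \notin J n)) f i) < e.
  move=> ne; apply: unorm_sum_lt => [|i _ /andP[Pi iJ]].
    by rewrite (lt_trans _ ne)// invr_gt0 ltr0n.
  by rewrite (lt_trans _ ne)// HJ.
have /Nc[s us] : cauchy_sequence N u.
  move=> e /small[n0 le]; exists n0 => m n /le mle /le nle.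
  by rewrite /u fsum_sub unormB_lt// sub.
exists s => e e0.
move/converges_toP: us => /(_ _ e0)[n0 us].
have [n1 le] := small _ e0.
have nle := le _ (leq_maxr n0 n1).
have {}us := us _ (leq_maxl n0 n1).
set n := maxn n0 n1 in nle us.
exists (J n) => A JA.
rewrite -(subrK (u n) s) -addrA unormD_lt//; first by rewrite -opprB unormN.
rewrite fsum_sub addrC; apply: unormD_lt; rewrite ?unormN; first exact: sub.
(* Since [J n] lies in [A], the other half of the difference is an empty sum. *)
rewrite big1_seq ?unorm0// => i /andP[/andP[_ iA] iJ].
by rewrite (fsubsetP JA) in iA.
Qed.

End Summation.

End Ultrametric.

(** * Sums of reciprocals over finite groups *)

(** This is the logarithmic derivative of a product. It turns a sum of reciprocals [1 / (v + w)]
    into the derivative of a polynomial. *)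
Lemma horner_deriv_prod (K : fieldType) (I : Type) (s : seq I) (P : pred I)
    (p : I -> {poly K}) (x : K) : (forall i, P i -> (p i).[x] != 0) ->
  (\prod_(i <- s | P i) p i)^`().[x] =
  (\prod_(i <- s | P i) p i).[x] *
  \sum_(i <- s | P i) (p i)^`().[x] / (p i).[x].
Proof.
move=> px; elim: s => [|i s IH].
  by rewrite !big_nil derivC hornerC mulr0.
rewrite !big_cons; case: ifP => // /px pix.
rewrite derivM hornerD !hornerM IH mulrDr; congr (_ + _); last by rewrite mulrA.
by rewrite mulrAC mulrCA mulfV ?mulr1.
Qed.

(* The polynomial [\prod_w ('X + w)] over a finite subgroup is additive, hence
   has a constant derivative, which can be read off at 0. *)
Lemma subgroup_sum_inv (K : fieldType) (U : finZmodType) (H : {pred U})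
    (phi : U -> K) (v : K) :
  (forall x y, phi (x - y) = phi x - phi y) -> injective phi ->
  0 \in H -> {in H &, forall x y, x - y \in H} ->
  (forall w, w \in H -> v + phi w != 0) ->
  \sum_(w in H) (v + phi w)^-1 =
  (\prod_(w in H | w != 0) phi w) / \prod_(w in H) (v + phi w).
Proof.
move=> phiB phi_inj H0 HB vH.
have phi0 : phi 0 = 0 by rewrite -(subrr 0) phiB subrr.
have HN w : w \in H -> - w \in H by move=> wH; rewrite -sub0r HB.
have HD : {in H &, forall x y, x + y \in H}.
  by move=> x y xH yH; rewrite -[y]opprK HB ?HN.
have phiD x y : phi (x + y) = phi x + phi y.
  by rewrite -{1}[y]opprK phiB -[- y]sub0r phiB phi0 sub0r opprK.
(* [P 0] is the additive polynomial of the subgroup, and [P y] is its translate by [y]. *)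
pose P y : {poly K} := \prod_(w in H) ('X - (- (y + phi w))%:P).
have PE y x : (P y).[x] = \prod_(w in H) (x + y + phi w).
  rewrite horner_prod; apply: eq_bigr => w _.
  by rewrite hornerXsubC opprK addrA.
have Pmonic y : P y \is monic by apply: monic_prod_XsubC.
have szP y : size (P y) = #|H|.+1.
  by rewrite /P -big_enum /= size_prod_XsubC -cardE.
have Pshift y : P 0 \Po ('X + y%:P) = P y.
  rewrite rmorph_prod /=; apply: eq_bigr => w _.
  by rewrite comp_polyB comp_polyX comp_polyC add0r !polyCN !opprK polyCD addrA.
have Pper w x : w \in H -> (P 0).[x + phi w] = (P 0).[x].
  move=> wH; rewrite !PE !addr0 (reindex_inj (addIr (- w))) /=.
  apply: eq_big => [w'|w' _].
    apply/idP/idP => w'H; last exact: HB.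
    by rewrite -(subrK w w') HD.
  by rewrite phiB [phi w' - _]addrC addrA addrK.
have dP y : (P 0)^`().[y] = (P 0)^`().[0].
  (* [Q] vanishes at the [#|H|] points [phi w] by periodicity, while its size is at most [#|H|]
     because the leading terms cancel; so [Q = 0]. Differentiating at 0 gives the claim. *)
  pose Q := P y - P 0 - ((P 0).[y])%:P.
  have cardH : (0 < #|H|)%N by apply/card_gt0P; exists 0.
  have Q0 : Q = 0.
    apply: (@roots_geq_poly_eq0 _ _ [seq phi w | w <- enum H]).
    - apply/allP => x /mapP[w wH ->{x}]; rewrite mem_enum in wH.
      rewrite rootE /Q !hornerE -Pshift horner_comp !hornerE.
      rewrite [phi w + y]addrC Pper// -[phi w]add0r Pper//.
      rewrite (_ : (P 0).[0] = 0) ?subr0 ?subrr//.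
      by rewrite PE (bigD1 0)//= phi0 !addr0 mul0r.
    - by rewrite map_inj_uniq ?enum_uniq.
    - rewrite size_map -cardE; apply/leq_sizeP => j le.
      rewrite !coefB coefC gtn_eqF ?(leq_trans cardH)// subr0.
      move: le; rewrite leq_eqVlt => /predU1P[<-|lt].
        move/monicP: (Pmonic y); move/monicP: (Pmonic 0).
        by rewrite /lead_coef !szP /= => -> ->; rewrite subrr.
      by rewrite !nth_default ?subrr// szP.
  have := congr1 (fun p => p^`().[0]) Q0.
  rewrite /Q -Pshift !derivB deriv_comp derivC derivD derivX derivC !hornerE.
  rewrite horner_comp !hornerE !deriv0 horner0 subr0 => /eqP.
  by rewrite subr_eq0 => /eqP.
have Pv : (P 0).[v] = \prod_(w in H) (v + phi w) by rewrite PE addr0.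
have Pv0 : (P 0).[v] != 0 by rewrite Pv; apply/prodf_neq0.
rewrite -Pv; apply: (mulfI Pv0); rewrite [RHS]mulrC divfK//.
transitivity (P 0)^`().[v].
  rewrite horner_deriv_prod => [|w wH]; last first.
    by rewrite hornerXsubC opprK add0r vH.
  congr (_ * _); apply: eq_bigr => w _.
  by rewrite derivXsubC hornerXsubC opprK add0r hornerC mul1r.
(* The factor for [w = 0] is ['X], so at 0 the product rule leaves only the product of the other
   factors. *)
rewrite dP /P (bigD1 0)//= derivM derivXsubC hornerD !hornerM.
rewrite hornerXsubC hornerC.
rewrite phi0 !(add0r, oppr0) mul0r addr0 mul1r horner_prod.
by apply: eq_bigr => w _; rewrite hornerXsubC add0r opprK add0r.
Qed.

(** Translation by 1 permutes [F], yet adds [#|F|] to the sum of all its elements. *)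
Lemma finField_card_eq0 (F : finFieldType) : #|F|%:R = 0 :> F.
Proof.
have : \sum_(x : F) x = \sum_(x : F) (x + 1) by rewrite (reindex_inj (addIr 1)).
by rewrite big_split /= sumr_const -{1}[\sum_x x]addr0 => /addrI/esym.
Qed.

(** The quotient [iota (l A) / phi A] is invariant under nonzero scalars. Hence each of the [q - 1]
    nonzero values of [l] contributes as much as the value 1, and [q - 1 = -1] in [K]. *)
Lemma sum_over_scaling (F : finFieldType) (K : fieldType)
    (iota : {rmorphism F -> K}) (m n : nat) (l : 'M[F]_(m, n) -> F)
    (phi : 'M[F]_(m, n) -> K) :
  (forall c A, l (c *: A) = c * l A) ->
  (forall c A, phi (c *: A) = iota c * phi A) ->
  \sum_(A | A != 0) iota (l A) / phi A = - \sum_(A | l A == 1) (phi A)^-1.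
Proof.
move=> lZ phiZ.
have l0 : l 0 = 0 by rewrite -(scale0r 0) lZ mul0r.
transitivity (\sum_(A | l A != 0) iota (l A) / phi A).
  rewrite big_mkcond [RHS]big_mkcond; apply: eq_bigr => A _.
  case: (eqVneq A 0) => [->|_]; first by rewrite l0 eqxx.
  by case: (eqVneq (l A) 0) => // ->; rewrite rmorph0 mul0r.
rewrite (partition_big l (fun c => c != 0))//=.
transitivity (\sum_(c : F | c != 0) \sum_(A | l A == 1) (phi A)^-1).
  apply: eq_bigr => c c0.
  rewrite (reindex_inj (scalerI c0)).
  apply: eq_big => [A|A /andP[_ /eqP->]].
    rewrite lZ mulf_eq0 (negPf c0) -{2}[c]mulr1 (inj_eq (mulfI c0)).
    by case: (eqVneq (l A) 1) => [->|]; rewrite ?andbF// oner_eq0.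
  by rewrite phiZ invfM mulVKf// fmorph_eq0.
rewrite sumr_const -mulr_natr.
rewrite (_ : _%:R = -1) ?mulrN1//.
apply/eqP; rewrite -addr_eq0 natr1; apply/eqP.
rewrite -(rmorph_nat iota) (_ : _.+1 = #|F|) ?finField_card_eq0 ?rmorph0//.
rewrite [RHS](cardD1 0) inE add1n; congr _.+1.
by apply: eq_card => c; rewrite !inE andbT.
Qed.

(** * The absolute value and expansions in powers of [theta^-1] *)

Section AbsoluteValue.
Variables (F : finFieldType) (R : realType) (C : Cinfty F R).
Implicit Types (x y : C) (c : nat -> F).

Local Notation abs := (@cabs F R C).
Local Notation iota := (@cconst F R C).
Local Notation th := (theta C).
Local Notation CN := (@cabs_norm F R C).

Lemma cabs_gt0 x : (0 < (abs x)) = (x != 0).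
Proof. exact: unorm_gt0 CN x. Qed.

Lemma cabs1 : abs 1 = 1.
Proof.
have /lt0r_neq0 n0 : 0 < (abs 1) by rewrite cabs_gt0 oner_eq0.
by apply: (mulfI n0); rewrite -cabsM !mulr1.
Qed.

Lemma cabsX x n : abs (x ^+ n) = abs x ^+ n.
Proof. by elim: n => [|n IH]; rewrite ?cabs1// !exprS cabsM IH. Qed.

Lemma cabsV x : abs (x^-1) = (abs x)^-1.
Proof.
case: (eqVneq x 0) => [->|x0]; first by rewrite invr0 (unorm0 CN) invr0.
have /lt0r_neq0 n0 : 0 < (abs x) by rewrite cabs_gt0.
by apply: (mulfI n0); rewrite -cabsM !mulfV// cabs1.
Qed.

Lemma cabs_prod (I : Type) (s : seq I) (P : pred I) (f : I -> C) :
  abs (\prod_(i <- s | P i) f i) = \prod_(i <- s | P i) abs (f i).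
Proof. by apply: big_morph => [x y|]; rewrite ?cabsM ?cabs1. Qed.

(** From [u ^ q = u] the absolute value is a positive real with [(q - 1)]-st power 1. *)
Lemma cabs_cconst (u : F) : u != 0 -> abs (iota u) = 1.
Proof.
move=> u0; have iu0 : 0 < abs (iota u) by rewrite cabs_gt0 fmorph_eq0.
have := finNzRing_gt1 F.
have := congr1 (fun w : F => abs (iota w)) (expf_card u).
move: #|F| => [|[|q]]// uq _; rewrite rmorphXn cabsX exprS in uq.
apply/eqP; rewrite -(@pexpr_eq1 _ _ q.+1) ?ltW//; apply/eqP.
by apply: (mulfI (lt0r_neq0 iu0)); rewrite uq mulr1.
Qed.

Lemma cabs_cconst_le1 (u : F) : abs (iota u) <= 1.
Proof.
case: (eqVneq u 0) => [->|/cabs_cconst->//].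
by rewrite rmorph0 (unorm0 CN) ler01.
Qed.

Lemma cabs_theta_gt1 : 1 < abs th.
Proof. by rewrite cabs_theta ltr1n finNzRing_gt1. Qed.

Lemma theta_neq0 : th != 0.
Proof. by rewrite -cabs_gt0 (lt_trans ltr01) ?cabs_theta_gt1. Qed.

Lemma cabs_thetaV n : abs (th ^- n) = abs th ^- n.
Proof. by rewrite cabsV cabsX. Qed.

Lemma cabs_thetaV_le m n : (m <= n)%N -> abs th ^- n <= abs th ^- m.
Proof.
move=> mn; have th0 : 0 < (abs th) by rewrite cabs_gt0 theta_neq0.
by rewrite lef_pV2 ?posrE ?exprn_gt0// ler_eXn2l ?cabs_theta_gt1.
Qed.

Lemma cabs_thetaV_small (B e : R) : 0 < e ->
  exists n, abs th ^- n * B < e.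
Proof.
(* This exponent makes [2 ^ n] exceed [B / e], and [abs th = q] is at least 2. *)
move=> e0; exists (Num.bound (B / e)).
set n := Num.bound _.
have th0 : 0 < (abs th) by rewrite cabs_gt0 theta_neq0.
rewrite mulrC ltr_pdivrMr ?exprn_gt0// mulrC -ltr_pdivrMr//.
apply: (@lt_le_trans _ _ (2 ^+ n)); first exact: upper_nthrootP.
by rewrite lerXn2r ?nnegrE ?(ltW th0)// cabs_theta ler_nat finNzRing_gt1.
Qed.

Definition digit_sum c n : C := \sum_(k < n) iota (c k) * th ^- k.

Lemma digit_sumB c c' n :
  digit_sum (fun k => c k - c' k) n = digit_sum c n - digit_sum c' n.
Proof.
by rewrite -sumrB; apply: eq_bigr => k _; rewrite rmorphB mulrBl.
Qed.

Lemma digit_sum_widen c m n : (m <= n)%N ->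
  digit_sum c m = digit_sum (fun k => if (k < m)%N then c k else 0) n.
Proof.
move=> mn; rewrite /digit_sum.
rewrite (big_ord_widen _ (fun k => iota (c k) * th ^- k) mn).
rewrite big_mkcond; apply: eq_bigr => k _.
by case: ifP; rewrite ?rmorph0 ?mul0r.
Qed.

Lemma digit_sum_le c m n : (forall k, (k < m)%N -> c k = 0) ->
  abs (digit_sum c n) <= abs th ^- m.
Proof.
move=> c0; have th0 : 0 < (abs th) by rewrite cabs_gt0 theta_neq0.
apply: (unorm_sum_le CN) => [|k _]; first by rewrite invr_ge0 exprn_ge0 ?ltW.
rewrite cabsM cabs_thetaV; case: (ltnP k m) => km.
  by rewrite c0// rmorph0 (unorm0 CN) mul0r invr_ge0 exprn_ge0 ?ltW.
rewrite (le_trans _ (cabs_thetaV_le km))// ler_piMl ?cabs_cconst_le1//.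
by rewrite invr_ge0 exprn_ge0 ?ltW.
Qed.

Lemma digit_sum_cvg c : exists x, converges_to (@cabs F R C) (digit_sum c) x.
Proof.
apply: (@Cinfty_complete F R C) => e e0.
have [n0] := cabs_thetaV_small 1 e0; rewrite mulr1 => n0e; exists n0.
have diff m n : (n0 <= m)%N -> (m <= n)%N ->
    abs (digit_sum c n - digit_sum c m) < e.
  move=> n0m mn; rewrite (digit_sum_widen c mn) -digit_sumB.
  apply: (le_lt_trans _ n0e); apply: digit_sum_le => k kn0.
  by rewrite (leq_trans kn0) ?subrr.
move=> m n n0m n0n; case: (leqP m n) => [mn|/ltnW nm]; last exact: diff.
by rewrite -opprB (unormN CN) diff.
Qed.

(** Far partial sums of [c] are close to [x], and their difference with the finite expansion [c']
    has its first [m] digits equal to 0. *)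
Lemma digit_limit_approx c c' m n x :
  converges_to (@cabs F R C) (digit_sum c) x ->
  (forall k, (k < m)%N -> c k = c' k) -> (forall k, (n <= k)%N -> c' k = 0) ->
  abs (x - digit_sum c' n) <= abs th ^- m.
Proof.
have th0 : 0 < (abs th) by rewrite cabs_gt0 theta_neq0.
move=> /(converges_toP CN) cx cc' c'0.
have [|k0 xk0] := cx (abs th ^- m); first by rewrite invr_gt0 exprn_gt0.
pose N := maxn k0 n.
rewrite -(subrK (digit_sum c N) x) -addrA (le_trans (unormD CN _ _))// ge_max.
rewrite -opprB (unormN CN) (ltW (xk0 _ (leq_maxl _ _))) /=.
rewrite (digit_sum_widen c' (leq_maxr k0 n)) -digit_sumB.
apply: digit_sum_le => k km; rewrite cc'//.
by case: ltnP => [|/c'0->]; rewrite subrr.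
Qed.

(** Dividing by [theta ^ s] reverses the coefficients into digits. The guard stops the truncated
    subtraction [s - k] from repeating the constant coefficient beyond [k = s]. *)
Lemma A_embed_digits (p : {poly F}) (s : nat) : (size p <= s.+1)%N ->
  A_embed C p = th ^+ s *
    digit_sum (fun k => if (k < s.+1)%N then p`_(s - k) else 0) s.+1.
Proof.
move=> ps; rewrite /A_embed (@horner_coef_wide _ s.+1); last first.
  exact: leq_trans (size_poly _ _) ps.
rewrite mulr_sumr (reindex_inj rev_ord_inj) /=; apply: eq_bigr => k _.
have ks : (k <= s)%N by rewrite -ltnS.
rewrite ltn_ord subSS coef_map mulrCA; congr (_ * _).
apply: (mulIf (expf_neq0 k theta_neq0)).
by rewrite divfK ?expf_neq0 ?theta_neq0// -exprD subnK.
Qed.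

End AbsoluteValue.

(** * Discreteness of the lattice of all [pairing z a] *)

(** Otherwise [U] would contain the complements of all the finitely many fibres of [g], hence their
    empty intersection. *)
Lemma ultrafilter_const (T : Type) (D : finType) (U : set_system T)
    (g : T -> D) :
  UltraFilter U -> exists d, U [set t | g t = d].
Proof.
move=> FU; apply: contrapT => /forallNP Ug.
have : U [set t | forall d, g t <> d].
  apply: filter_forall => d.
  by have [/(Ug d)|] := in_ultra_setVsetC [set t | g t = d] FU.
by move=> /filter_ex[t /(_ (g t))].
Qed.

Section Lattice.
Variables (F : finFieldType) (R : realType) (C : Cinfty F R).
Variables (r : nat) (z : 'rV[C]_r).
Implicit Types a b : 'cV[{poly F}]_r.

Local Notation abs := (@cabs F R C).
Local Notation iota := (@cconst F R C).
Local Notation th := (theta C).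
Local Notation CN := (@cabs_norm F R C).

Lemma pairingE a : pairing z a = \sum_j z 0 j * A_embed C (a j 0).
Proof. by rewrite /pairing mxE; apply: eq_bigr => j _; rewrite mxE. Qed.

Lemma A_embedB (p q : {poly F}) : A_embed C (p - q) = A_embed C p - A_embed C q.
Proof. by rewrite /A_embed rmorphB /= hornerD hornerN. Qed.

Lemma A_embedM (p q : {poly F}) : A_embed C (p * q) = A_embed C p * A_embed C q.
Proof. by rewrite /A_embed rmorphM /= hornerM. Qed.

Lemma pairingB a b : pairing z (a - b) = pairing z a - pairing z b.
Proof.
rewrite !pairingE -sumrB; apply: eq_bigr => j _.
by rewrite !mxE A_embedB mulrBr.
Qed.

Lemma pairing0 : pairing z 0 = 0.
Proof. by rewrite -(subrr 0) pairingB subrr. Qed.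

Lemma pairingD a b : pairing z (a + b) = pairing z a + pairing z b.
Proof.
by rewrite -[b in LHS]opprK pairingB -[- b]sub0r pairingB pairing0 sub0r opprK.
Qed.

Lemma pairingZ (p : {poly F}) a :
  pairing z (p *: a) = A_embed C p * pairing z a.
Proof.
rewrite !pairingE mulr_sumr; apply: eq_bigr => j _.
by rewrite !mxE A_embedM mulrCA.
Qed.

Definition colsize a : nat := \max_j size (a j 0%R).

Lemma size_le_colsize a j : (size (a j 0%R) <= colsize a)%N.
Proof. exact: leq_bigmax_cond. Qed.

Hypothesis Oz : Omega z.

(* If lattice points of bounded absolute value had unbounded degree, scaling
   them by powers of [theta^-1] and passing to the limit along an ultrafilter,
   digit by digit, would give a nontrivial [K_oo]-linear relation on [z]. *)
Lemma pairing_discrete (B : R) :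
  exists d, forall a, (d < colsize a)%N -> B < abs (pairing z a).
Proof.
apply: contrapT => /forallNP nB.
have /choice[a aP] n : exists a, (n < colsize a)%N /\ abs (pairing z a) <= B.
  have /existsNP[a /not_implyP[na /negP]] := nB n.
  by rewrite -leNgt; exists a.
pose s n := (colsize (a n)).-1.
have sE n : colsize (a n) = (s n).+1.
  by rewrite prednK// (leq_ltn_trans _ (aP n).1).
(* The [k]-th digits of [theta ^- (s n)] times [a n], for all coordinates together. *)
pose dig n k : {ffun 'I_r -> F} :=
  [ffun j => if (k < (s n).+1)%N then (a n j 0)`_(s n - k) else 0].
have [U [FU leU]] := ultraFilterLemma eventually_filter.
have /choice[c cP] k : exists d, U [set n | dig n k = d].
  exact: (ultrafilter_const (fun n => dig n k) FU).
have Uex m n0 : exists n, (n0 <= n)%N /\ forall k, (k < m)%N -> dig n k = c k.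
  have U1 : U [set n | (n0 <= n)%N] by apply: leU; exists n0.
  have U2 : U [set n | forall k : 'I_m, dig n k = c k].
    by apply: filter_forall => k; apply: cP.
  have [n [n0n nc]] := filter_ex (filterI U1 U2).
  by exists n; split=> // k km; apply: (nc (Ordinal km)).
(* Some coordinate of [a n] attains the top degree [s n], so its digit of index 0 is a nonzero
   leading coefficient. *)
have [j0 cj0] : exists j, c 0 j != 0.
  have [n [_ nc]] := Uex 1 0.
  have : (colsize (a n) != 0)%N by rewrite sE.
  have r0 : (0 < #|'I_r|)%N.
    rewrite card_ord lt0n; apply/eqP => r0; have := sE n.
    by rewrite /colsize big1// => -[k kr]; exfalso; move: kr; rewrite r0.
  have [j aj] := @bigop.eq_bigmax _ (fun j => size (a n j 0)) r0.
  rewrite -/(colsize (a n)) in aj.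
  rewrite aj => sj; exists j; rewrite -nc// ffunE /= subn0.
  have := lead_coef_eq0 (a n j 0); rewrite /lead_coef -aj sE /= => ->.
  by rewrite -size_poly_eq0.
have /choice[x xP] j := digit_sum_cvg C (fun k => c k j).
have x0 : forall j, x j = 0.
  apply: Oz.2 => [j|].
    exists 0, (fun k => c k j).
    rewrite (_ : (fun n => _) = digit_sum C (fun k => c k j))//.
    by apply/funext => n; rewrite expr0 mul1r.
  apply/eqP; rewrite -[_ == 0]negbK -(cabs_gt0 (C := C)); apply/negP => e0.
  set e := abs _ in e0.
  pose Z := \big[Num.max/1]_j abs (z 0 j).
  have Z0 : 0 < Z by rewrite (lt_le_trans ltr01)// bigmax_ge_id.
  (* Agreement in [m] digits makes the pairing of [x - y] smaller than [e]; scaling by at least [n0]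
     powers of [theta] makes that of [y] smaller than [e]. *)
  have [m mZ] := cabs_thetaV_small C Z e0.
  have [n0 n0B] := cabs_thetaV_small C B e0.
  have [n [n0n nc]] := Uex m n0.
  have th0 : 0 < abs th by rewrite cabs_gt0 theta_neq0.
  pose y j := digit_sum C (fun k => dig n k j) (s n).+1.
  have ns : (n0 <= s n)%N by rewrite (leq_trans n0n)// -ltnS -sE (aP n).1.
  have yE : \sum_j y j * z 0 j = th ^- (s n) * pairing z (a n).
    rewrite pairingE mulr_sumr; apply: eq_bigr => j _.
    rewrite (@A_embed_digits _ _ _ _ (s n)) -?sE ?size_le_colsize//.
    rewrite mulrCA [in RHS]mulrC.
    rewrite mulKf ?expf_neq0 ?theta_neq0//; congr (_ * _).
    by rewrite sE; apply: eq_bigr => k _; rewrite ffunE.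
  have ylt : abs (\sum_j y j * z 0 j) < e.
    rewrite yE cabsM cabs_thetaV (le_lt_trans _ n0B)//.
    apply: ler_pM; rewrite ?invr_ge0 ?exprn_ge0 ?(ltW th0) ?(norm_ge0 CN)//.
      exact: cabs_thetaV_le.
    exact: (aP n).2.
  have xylt : abs (\sum_j (x j - y j) * z 0 j) < e.
    apply: le_lt_trans mZ; apply: (unorm_sum_le CN) => [|j _].
      by rewrite mulr_ge0 ?invr_ge0 ?exprn_ge0 ?(ltW th0) ?(ltW Z0).
    rewrite cabsM; apply: ler_pM; rewrite ?(norm_ge0 CN)//; last first.
      exact: le_bigmax.
    apply: (digit_limit_approx (xP j)) => k km; first by rewrite nc.
    by rewrite ffunE ltnNge km.
  have := unormD_lt CN xylt ylt; rewrite -big_split /=.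
  under eq_bigr do rewrite -mulrDl subrK.
  by rewrite ltxx.
(* Comparing [x j0 = 0] with its leading digit alone bounds that digit by [abs th ^- 1 < 1], but a
   nonzero constant has absolute value 1. *)
have := @digit_limit_approx _ _ _ (fun k => c k j0)
  (fun k => if k is 0 then c 0 j0 else 0) 1 1 _ (xP j0).
rewrite x0 sub0r (unormN CN) /digit_sum big_ord1 expr0 invr1 mulr1.
rewrite cabs_cconst//.
move=> /(_ _ _)/le_gtF/negP; apply => //.
- by case.
- by case.
by rewrite expr1 invf_lt1 ?cabs_theta_gt1// cabs_gt0 theta_neq0.
Qed.

(** A nonzero [a] with zero pairing would have multiples ['X^d *: a] of unbounded degree, all with
    zero pairing, against discreteness. *)
Lemma pairing_neq0 a : a != 0 -> pairing z a != 0.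
Proof.
move=> a0; apply/eqP => za0; have [d dP] := pairing_discrete 0.
have [j aj] : exists j, a j 0 != 0.
  apply: contrapT => /forallNP aj; case/eqP: a0; apply/colP => j.
  by have /negP := aj j; rewrite negbK => /eqP->; rewrite mxE.
suff : (d < colsize ('X^d *: a))%N.
  by move=> /dP; rewrite pairingZ za0 mulr0 (unorm0 CN) ltxx.
rewrite (leq_trans _ (size_le_colsize _ j))// mxE mulrC size_mulXn//.
by rewrite -addn1 leq_add2l size_poly_gt0.
Qed.

Lemma pairing_inj : injective (pairing z).
Proof.
move=> a b ab; apply/eqP; rewrite -subr_eq0; apply/negP => /negP/pairing_neq0.
by rewrite pairingB ab subrr eqxx.
Qed.

End Lattice.

(** * Truncation to finitely many columns of bounded degree *)

Section Box.
Variables (F : finFieldType) (r : nat).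
Implicit Types a : 'cV[{poly F}]_r.

(** Coefficient matrices form a finite type with an [F]-linear structure, on which the identities
    for finite groups apply. *)
Definition polycol d (A : 'M[F]_(r, d)) : 'cV[{poly F}]_r :=
  \col_j rVpoly (row j A).

Definition box d : {fset 'cV[{poly F}]_r} :=
  [fset polycol A | A in {: 'M[F]_(r, d)}]%fset.

Lemma polycolB d (A B : 'M[F]_(r, d)) : polycol (A - B) = polycol A - polycol B.
Proof. by apply/colP => j; rewrite !mxE !linearB. Qed.

Lemma polycolD d (A B : 'M[F]_(r, d)) : polycol (A + B) = polycol A + polycol B.
Proof. by apply/colP => j; rewrite !mxE !linearD. Qed.

Lemma polycolZ d c (A : 'M[F]_(r, d)) : polycol (c *: A) = c%:P *: polycol A.
Proof. by apply/colP => j; rewrite !mxE !linearZ /= mul_polyC. Qed.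

Lemma polycol_inj d : injective (@polycol d).
Proof.
move=> A B AB; apply/row_matrixP => j; apply: (can_inj rVpolyK).
by have /colP/(_ j) := AB; rewrite !mxE.
Qed.

Lemma polycol0 d : polycol (0 : 'M[F]_(r, d)) = 0.
Proof. by rewrite -(subrr 0) polycolB subrr. Qed.

Lemma polycol_eq0 d (A : 'M[F]_(r, d)) : (polycol A == 0) = (A == 0).
Proof. by rewrite -(inj_eq (@polycol_inj d)) polycol0. Qed.

Lemma in_box d a : (a \in box d) = (colsize a <= d)%N.
Proof.
apply/imfsetP/idP => [[A _ ->]|ad].
  by apply/bigmax_leqP => j _; rewrite mxE size_poly.
exists (\matrix_(j, k) (a j 0)`_k) => //; apply/colP => j.
rewrite mxE -[LHS](@poly_rV_K _ d); last first.
  exact: leq_trans (size_le_colsize a j) ad.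
by congr rVpoly; apply/rowP => k; rewrite !mxE.
Qed.

Lemma fsubset_box d d' : (d <= d')%N -> (box d `<=` box d')%fset.
Proof. by move=> dd'; apply/fsubsetP => a; rewrite !in_box => /leq_trans->. Qed.

Lemma big_box (T : Type) (idx : T) (op : Monoid.com_law idx) d
    (P : pred 'cV[{poly F}]_r) (f : 'cV[{poly F}]_r -> T) :
  \big[op/idx]_(a <- box d | P a) f a =
  \big[op/idx]_(A : 'M[F]_(r, d) | P (polycol A)) f (polycol A).
Proof.
rewrite big_mkcond big_imfset /=; last by move=> A B _ _ /polycol_inj.
by rewrite big_enum -big_mkcond.
Qed.

End Box.

(** * The constant term of the truncated Eisenstein sums *)

Section ConstantTerm.
Variables (F : finFieldType) (R : realType) (C : Cinfty F R).
Variables (r : nat) (z : 'rV[C]_r) (i : 'I_r).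
Hypothesis Oz : Omega z.

Local Notation abs := (@cabs F R C).
Local Notation iota := (@cconst F R C).
Local Notation CN := (@cabs_norm F R C).
Local Notation cst a := ((a : 'cV[{poly F}]_r) i 0)`_0.
Local Notation e_i := (delta_mx i 0 : 'cV[{poly F}]_r).
Local Notation zi := (pairing z e_i).

Lemma cst_delta : cst e_i = 1.
Proof. by rewrite mxE !eqxx coef1. Qed.

Lemma pairing_delta_neq0 a : cst a = 0 -> zi + pairing z a != 0.
Proof.
move=> a0; rewrite -pairingD pairing_neq0//.
apply/eqP => /(congr1 (fun b => cst b)).
rewrite [in LHS]mxE coefD cst_delta a0 addr0 mxE coef0 => /eqP.
by rewrite oner_eq0.
Qed.

(** The bound [d.+1] puts the unit column [e_i] in the box. The final quotient by [abs zi] is the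
    factor for [w = 0] in the denominator. *)
Lemma box_constant_sum d :
  abs (\sum_(a <- box F r d.+1 | a != 0) iota (cst a) / pairing z a) =
  (\prod_(a <- box F r d.+1 | (cst a == 0) && (a != 0))
     (abs (pairing z a) / abs (zi + pairing z a))) / abs zi.
Proof.
pose phi (A : 'M[F]_(r, d.+1)) := pairing z (polycol A).
pose l (A : 'M[F]_(r, d.+1)) := cst (polycol A).
have lB A B : l (A - B) = l A - l B by rewrite /l polycolB !mxE coefB.
have l0 : l 0 = 0 by rewrite -(subrr 0) lB subrr.
have phiB A B : phi (A - B) = phi A - phi B by rewrite /phi polycolB pairingB.
have phi0 : phi 0 = 0 by rewrite -(subrr 0) phiB subrr.
have [E Ei] : exists E : 'M[F]_(r, d.+1), polycol E = e_i.
  have : e_i \in box F r d.+1.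
    rewrite in_box; apply/bigmax_leqP => j _; rewrite mxE.
    by case: (_ && _); rewrite ?size_poly1 ?size_poly0.
  by move=> /imfsetP[E _ ->]; exists E.
have lE : l E = 1 by rewrite /l Ei cst_delta.
have phiE A : phi (A + E) = zi + phi A.
  by rewrite /phi polycolD pairingD Ei addrC.
rewrite !big_box.
transitivity (abs (\sum_(A : 'M[F]_(r, d.+1) | A != 0) iota (l A) / phi A)).
  by congr abs; apply: eq_bigl => A; rewrite polycol_eq0.
rewrite sum_over_scaling; first last.
- by move=> c A; rewrite /phi polycolZ pairingZ /A_embed map_polyC hornerC.
- by move=> c A; rewrite /l polycolZ mxE mul_polyC coefZ.
(* Translation by [E] carries the subgroup [l A = 0] to the coset [l A = 1]. *)
rewrite (unormN CN) (reindex_inj (addIr E)).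
pose H := [pred A : 'M[F]_(r, d.+1) | l A == 0].
have vH A : A \in H -> zi + phi A != 0.
  by rewrite inE => /eqP lA; apply: pairing_delta_neq0.
transitivity (abs (\sum_(A in H) (zi + phi A)^-1)).
  congr abs; apply: eq_big => [A|A _]; last by rewrite phiE.
  by rewrite inE -{2}[A](addrK E) lB lE subr_eq0.
rewrite (@subgroup_sum_inv C _ H phi zi) //; first last.
- by move=> A B; rewrite !inE lB => /eqP-> /eqP->; rewrite subrr.
- by rewrite inE l0.
- by move=> A B /(pairing_inj Oz)/polycol_inj.
rewrite cabsM cabsV !cabs_prod.
rewrite (bigD1 (0 : 'M[F]_(r, d.+1)) (P := mem H)) /=; last first.
  by rewrite inE l0.
rewrite phi0 addr0 invfM mulrCA mulrC; congr (_ / _).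
rewrite -prodf_div; by apply: eq_bigl => A; rewrite polycol_eq0.
Qed.

Lemma box_constant_sum_stable : exists d0 (delta : R), 0 < delta /\
  forall d, (d0 <= d)%N ->
    abs (\sum_(a <- box F r d | a != 0) iota (cst a) / pairing z a) = delta.
Proof.
have [d0 d0P] := pairing_discrete Oz (abs zi).
pose g a := if (cst a == 0) && (a != 0)
  then abs (pairing z a) / abs (zi + pairing z a) else 1.
have v0 : 0 < abs zi.
  have := @pairing_delta_neq0 0; rewrite mxE coef0 => /(_ erefl).
  by rewrite pairing0 addr0 cabs_gt0.
exists d0.+1, ((\prod_(a <- box F r d0.+1) g a) / abs zi); split.
  rewrite divr_gt0// big_seq prodr_gt0// => a _.
  rewrite /g; case: ifP => [/andP[/eqP a0 aN0]|_]; last exact: ltr01.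
  by rewrite divr_gt0 ?cabs_gt0 ?pairing_neq0 ?pairing_delta_neq0.
move=> [//|d] dd0; rewrite box_constant_sum big_mkcond; congr (_ / _).
(* Outside the smaller box the lattice point dominates [zi], so every new factor is 1. *)
apply/esym/big_fset_incl => [|a _]; first exact: fsubset_box.
rewrite in_box -ltnNge => ad; rewrite /g; case: ifP => // /andP[_ aN0].
by rewrite (unormD_eq CN) ?divff ?d0P ?gt_eqF ?cabs_gt0 ?pairing_neq0 // ltnW.
Qed.

End ConstantTerm.

(** * Convergence and non-vanishing in the Tate algebra *)

Section Tate.
Variables (F : finFieldType) (R : realType) (C : Cinfty F R).
Variable T : tate_algebra C.

Local Notation abs := (@cabs F R C).
Local Notation iota := (@cconst F R C).
Local Notation CN := (@cabs_norm F R C).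
Local Notation TN := (@tnorm_norm F R C T).

Lemma cabs_coef_le_gauss (p : {poly C}) k : abs p`_k <= gauss_norm p.
Proof.
rewrite /gauss_norm; case: (ltnP k (size p)) => [kp|/(nth_default 0)->].
  exact: (le_bigmax _ (fun k : 'I_(size p) => abs p`_k) (Ordinal kp)).
by rewrite (unorm0 CN) bigmax_ge_id.
Qed.

Lemma tnorm_chi_le1 (p : {poly F}) : tnorm (chi_t T p) <= 1.
Proof.
rewrite /chi_t tnorm_tpoly; apply: bigmax_le => [|k _]; first exact: ler01.
by rewrite coef_map cabs_cconst_le1.
Qed.

Variables (r : nat) (z : 'rV[C]_r) (i : 'I_r).
Hypothesis Oz : Omega z.

Local Notation term := (fun a : 'cV[{poly F}]_r =>
  (pairing z a)^-1 *: rho_t T a i 0).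

Lemma epsilon_vanishing_family :
  vanishing_family (@tnorm F R C T) [pred a : 'cV[{poly F}]_r | a != 0] term.
Proof.
move=> e e0; have [d dP] := pairing_discrete Oz e^-1.
exists (box F r d) => a; rewrite in_box -ltnNge => /dP za _.
have za0 : 0 < abs (pairing z a) by rewrite (lt_trans _ za)// invr_gt0.
rewrite tnormZ cabsV mxE (@le_lt_trans _ _ (abs (pairing z a))^-1)//.
  by rewrite ler_piMr ?tnorm_chi_le1// invr_ge0 ltW.
by rewrite invf_plt.
Qed.

(** A finite sum is the image of a polynomial in [t], whose Gauss norm bounds its coefficient of
    index 0. *)
Lemma constant_term_le (s : seq 'cV[{poly F}]_r) (P : pred 'cV[{poly F}]_r) :
  abs (\sum_(a <- s | P a) iota (a i 0)`_0 / pairing z a) <=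
  tnorm (\sum_(a <- s | P a) term a).
Proof.
pose p : {poly C} :=
  \sum_(a <- s | P a) (pairing z a)^-1 *: map_poly iota (a i 0).
rewrite (_ : \sum_(a <- s | P a) term a = tpoly T p).
  rewrite tnorm_tpoly (le_trans _ (cabs_coef_le_gauss p 0))// coef_sum.
  by under [X in _ <= abs X]eq_bigr do rewrite coefZ coef_map mulrC.
rewrite /p linear_sum; apply: eq_bigr => a _.
by rewrite linearZ /= /rho_t mxE.
Qed.

(** If the sum were 0, all large finite partial sums would have norm below [delta], whereas those
    over large boxes have norm at least [delta]. *)
Lemma epsilon_neq0 : epsilon T i z <> 0.
Proof.
rewrite /epsilon mxE => eps0.
have [s sP] :=
  vanishing_has_sum TN (@tate_complete F R C T) epsilon_vanishing_family.
(* As the family is summable, the value chosen by [xget] is a genuine sum and not the default 0. *)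
have := xgetPex 0 (ex_intro _ s sP : exists s, [set s | has_sum _ _ _ s] s).
rewrite -/(infinite_sum _ _ _) eps0 => sum0.
have [d0 [delta [delta0 deltaP]]] := box_constant_sum_stable i Oz.
have [J0 /(_ _) J0P] := sum0 _ delta0.
pose d := maxn d0 (\max_(a : J0) colsize (val a)).
have /J0P : (J0 `<=` box F r d)%fset.
  apply/fsubsetP => a aJ; rewrite in_box leq_max; apply/orP; right.
  exact: (leq_bigmax_cond (F := fun a : J0 => colsize (val a)) [` aJ]%fset).
rewrite sub0r (unormN TN) -(deltaP d) ?leq_maxl//.
by rewrite ltNge constant_term_le.
Qed.

End Tate.

Theorem corollary4p6 (F : finFieldType) (R : realType) (C : Cinfty F R)
    (T : tate_algebra C) (r : nat) (hr : (2 <= r)%N) :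
  (forall (i : 'I_r) (z : 'rV[C]_r), Omega z -> epsilon T i z <> 0) /\
  (forall z : 'rV[C]_r, Omega z -> eisenstein1 T z <> 0).
Proof.
split=> [i z|z Oz E0]; first exact: epsilon_neq0.
apply: (@epsilon_neq0 _ _ _ T _ _ (Ordinal (ltnW hr)) Oz).
by rewrite /epsilon E0 mxE.
Qed.
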